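(* Let $K$ be a field, $G$ a finitely generated abelian group, $R$ a noetherian $G$-graded $K$-algebra for which $R_0$ is a finitely generated $K$-algebra, and $M$ a finitely generated $G$-graded $R$-module. Consider a finitely generated subsemigroup $S$ of $G$ containing the elements $\deg r$ for all homogeneous $r\in R\setminus\{0\}$, and a finitely generated $S$-submodule $T$ of $G$ containing the elements $\deg x$ for all homogeneous $x\in M\setminus\{0\}$. Let $H$ be the $G$-graded Hilbert function, $H(M,t)=\dim_K M_t$ for all $t\in G$. Suppose that $\lim_{k\to\infty} H(M,kc+d)=\infty$ for all choices of $c\in S$, $c$ not a torsion element of $G$, and $d\in T$. Then $$ \#\{t\in T: H(M,t)\le C\} <\infty $$ for all $C\in\mathbb{Z}_+$.
   Context: Rings are commutative. A $G$-graded $K$-algebra is $R=\bigoplus_{g\in G}R_g$ with $K\subset R_0$ and $R_gR_h\subset R_{g+h}$; a $G$-graded module is $M=\bigoplus_{g\in G}M_g$ with $R_gM_h\subset M_{g+h}$. The graded components may have infinite $K$-dimension, so $H$ takes values in $\mathbb{Z}_+\cup\{\infty\}$. A subsemigroup of $G$ contains $0$. For a subsemigroup $S$ of $G$, a subset $T\subset G$ is an $S$-module (an $S$-submodule of $G$) if $S+T\subset T$ (the case $T=\emptyset$ is allowed); it is finitely generated if it is a finite union of translates $S+t$, $t\in T$. *)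

(* Defs.v *)
From HB Require Import structures.
From mathcomp Require Import all_boot all_order all_algebra.
From mathcomp Require Import all_classical.
From mathcomp Require Import reals ereal topology normedtype sequences.
Set Implicit Arguments.
Unset Strict Implicit.
Unset Printing Implicit Defensive.
Import Order.TTheory GRing.Theory Num.Theory.
Local Open Scope classical_set_scope.
Local Open Scope ring_scope.

(* [smallest C B] is the intersection of all sets satisfying C that contain B,
   i.e. the substructure generated by B when C is a closure property. *)
Definition finitely_generated (V : Type) (C : set V -> Prop) (A : set V) :=
  exists2 B : set V, finite_set B & A = smallest C B.

Definition subgroup (V : zmodType) (A : set V) := GRing.zmod_closed (mem A).

Definition subsemigroup (V : zmodType) (A : set V) := GRing.nmod_closed (mem A).

Definition submodule (R : nzRingType) (V : lmodType R) (A : set V) :=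
  GRing.submod_closed (mem A).

Definition subalgebra (K : nzRingType) (R : algType K) (A : set R) :=
  GRing.subalg_closed (mem A).

Definition noetherian (R : comNzRingType) :=
  forall I : set R^o, submodule I -> finitely_generated (@submodule R R^o) I.

Definition torsion (G : zmodType) (c : G) := exists2 n, (0 < n)%N & c *+ n = 0.

Definition semigroup_module (G : zmodType) (S T : set G) :=
  forall s t, S s -> T t -> T (s + t).

Definition fg_semigroup_module (G : zmodType) (S T : set G) :=
  semigroup_module S T /\
  exists B : set G, [/\ finite_set B, B `<=` T
    & T = \bigcup_(t in B) [set s + t | s in S]].

(* V is the internal direct sum of the subgroups V_ g.  The finite support has
   to be required explicitly: \sum_(g \in setT) is 0 on infinite supports. *)
Definition direct_sum (G : choiceType) (V : zmodType) (V_ : G -> set V) :=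
  (forall g, subgroup (V_ g)) /\
  forall v, exists! f : G -> V,
    [/\ forall g, V_ g (f g), finite_set [set g | f g != 0]
      & v = \sum_(g \in setT) f g].

Definition graded_algebra (K : fieldType) (G : zmodType) (R : comAlgType K)
    (R_ : G -> set R) :=
  [/\ direct_sum R_,
      forall a : K, R_ 0 a%:A
    & forall g h r s, R_ g r -> R_ h s -> R_ (g + h) (r * s)].

Definition graded_module (K : fieldType) (G : zmodType) (R : comAlgType K)
    (M : lmodType R) (R_ : G -> set R) (M_ : G -> set M) :=
  direct_sum M_ /\
  forall g h r x, R_ g r -> M_ h x -> M_ (g + h) (r *: x).

(* An R-module is viewed as a K-vector space through a |-> a%:A : R. *)
Definition basis_over (K : fieldType) (R : comAlgType K) (M : lmodType R)
    (W : set M) (n : nat) (b : 'I_n -> M) :=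
  [/\ forall i, W (b i),
      forall a : 'I_n -> K,
        \sum_(i < n) (a i)%:A *: b i = 0 -> forall i, a i = 0
    & forall x, W x -> exists a : 'I_n -> K, x = \sum_(i < n) (a i)%:A *: b i].

Definition has_dim (K : fieldType) (R : comAlgType K) (M : lmodType R)
    (W : set M) (n : nat) := exists b : 'I_n -> M, basis_over W b.

(* The values are natural numbers or +oo; they are taken in \bar rat for its
   order and its topology at +oo. *)
Definition dimension (K : fieldType) (R : comAlgType K) (M : lmodType R)
    (W : set M) : \bar rat :=
  if pselect (exists n, has_dim W n) is left W_fin
  then (projT1 (cid W_fin))%:R%:E else +oo%E.

Definition hilbert_function (K : fieldType) (G : zmodType) (R : comAlgType K)
    (M : lmodType R) (M_ : G -> set M) (t : G) : \bar rat := dimension (M_ t).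

(* Main.v *)
(* M has a filtration by graded submodules with quotients (R/P_i)(-d_i), where
   P_i is a homogeneous prime; so H(M, t) lies between the maximum and the sum
   of the Hilbert functions of these quotients.  Multiplication by homogeneous
   elements outside P_i shows that the set {t | dim (R/P_i)_(t - d_i) > C} is a
   module over the semigroup S_i of degrees of R/P_i, and noetherianity of R
   makes both S_i and this module finitely generated.  Hence these sets are
   definable in Presburger arithmetic, and by quantifier elimination so is the
   complement T \ W of their union W.  If infinitely many t satisfied
   H(M, t) <= C, then T \ W would be infinite, and Dickson's lemma would give a
   whole ray k c + d in T \ W with c in S not torsion; but H is bounded on
   T \ W. *)
Require Import Defs.
From HB Require Import structures.
From mathcomp Require Import all_boot all_order all_algebra.
From mathcomp Require Import all_classical.
From mathcomp Require Import reals ereal topology normedtype sequences.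
From mathcomp Require Import zify ring.
Set Implicit Arguments.
Unset Strict Implicit.
Unset Printing Implicit Defensive.
Import Order.TTheory GRing.Theory Num.Theory.
Local Open Scope classical_set_scope.
Local Open Scope ring_scope.

(** The ring side and the combinatorial side meet in [semigroup_noetherian]: it passes from [R] to
    the degrees of [R/P] through the ideals [degree_ideal], then to preimages under a surjection
    [pi] from a lattice onto [G]. The lattice is there because [G] may have torsion, whereas signs
    of affine functions and congruences want integer coordinates. A preimage contains the kernel of
    [pi], so it need not be pointed and minimal elements need not generate it; hence the induction
    on coordinates. [tame] sets are given by signs and a congruence rather than as unions of
    translates of semigroups: complements are then immediate, and the work goes into eliminating one
    natural coefficient per generator. *)

(** * Finitely generated and noetherian semigroups *)

Section NatSpan.
Variable V : zmodType.
Implicit Types (A S : set V) (ss : seq V).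

Lemma subsemigroupP A :
  subsemigroup A <-> A 0 /\ forall x y, A x -> A y -> A (x + y).
Proof.
split=> -[A0 AD]; split.
- by move: A0; rewrite inE.
- by move=> x y Ax Ay; move: (AD x y); rewrite !inE; apply.
- by rewrite inE.
- by move=> x y; rewrite !inE; apply: AD.
Qed.

Lemma subsemigroupMn A x k : subsemigroup A -> A x -> A (x *+ k).
Proof.
move=> /subsemigroupP[A0 AD] Ax; elim: k => [|k IHk]; first by rewrite mulr0n.
by rewrite mulrS; apply: AD.
Qed.

(** Peeling off one generator at a time makes membership a chain of existential quantifiers over
    natural numbers, the form that [tame_add_nat] eliminates. *)
Fixpoint nat_span ss : set V :=
  if ss is s :: ss' then [set x | exists k, nat_span ss' (x - s *+ k)]
  else [set 0].

Lemma nat_span_subsemigroup ss : subsemigroup (nat_span ss).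
Proof.
apply/subsemigroupP; elim: ss => [|s ss [IH0 IHD]] /=.
  by split=> // x y -> ->; rewrite addr0.
split; first by exists 0%N; rewrite mulr0n subr0.
move=> x y [k xk] [l yl]; exists (k + l)%N.
by rewrite mulrnDr opprD addrACA; apply: IHD.
Qed.

Lemma nat_span_mem ss x : x \in ss -> nat_span ss x.
Proof.
elim: ss => //= s ss IHs; rewrite inE => /orP[/eqP ->|/IHs xs].
  by exists 1%N; rewrite subrr; case/subsemigroupP: (nat_span_subsemigroup ss).
by exists 0%N; rewrite mulr0n subr0.
Qed.

Lemma nat_span_min A ss :
  subsemigroup A -> (forall x, x \in ss -> A x) -> nat_span ss `<=` A.
Proof.
move=> sgA; have /subsemigroupP[A0 AD] := sgA.
elim: ss => [_ x ->//|s ss IHs ssA x /= [k xk]].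
rewrite -(subrK (s *+ k) x); apply: AD.
  by apply: IHs => // y yss; apply: ssA; rewrite inE yss orbT.
by apply: subsemigroupMn => //; apply: ssA; rewrite mem_head.
Qed.

Lemma nat_span_sub ss ss' :
  {subset ss <= ss'} -> nat_span ss `<=` nat_span ss'.
Proof.
move=> sub; apply: nat_span_min => [|x /sub]; last exact: nat_span_mem.
exact: nat_span_subsemigroup.
Qed.

(* The semigroup counterpart of the noetherian property: every ideal of S is
   generated by finitely many elements of any given generating set A. *)
Definition semigroup_noetherian S :=
  forall A, A `<=` S -> exists2 ss : seq V, forall b, b \in ss -> A b &
    forall x, A x -> exists2 b, b \in ss & S (x - b).

Definition fg_monoid S := exists ss, S = nat_span ss.

Lemma morph_sub0 (l : V -> int) : {morph l : x y / x - y} -> l 0 = 0.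
Proof. by move=> lB; rewrite -(subrr 0) lB subrr. Qed.

(** Descent on the level [l x]: a high element is lowered by an element of [B], and an element of
    level [j < m] differs from some element of [L j] by one of level 0. *)
Lemma nat_span_half (S : set V) (l : V -> int) ss0 :
  subsemigroup S -> semigroup_noetherian S -> {morph l : x y / x - y} ->
  (forall x, S x -> l x = 0 -> nat_span ss0 x) ->
  (forall x, x \in ss0 -> S x) ->
  exists2 ss, forall x, x \in ss -> S x &
    forall x, S x -> 0 <= l x -> nat_span ss x.
Proof.
move=> sgS noS lB S0 ss0S; have /subsemigroupP[S0' SD] := sgS.
have [|B BA Bdom] := noS [set x | S x /\ 0 < l x]; first by move=> x [].
have /choice[L LP] : forall j : nat, exists ss : seq V,
    (forall b, b \in ss -> S b /\ l b = j) /\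
    forall x, S x -> l x = j -> exists2 b, b \in ss & S (x - b).
  move=> j; have [|ss ssA ssdom] := noS [set x | S x /\ l x = j].
    by move=> x [].
  by exists ss; split => // x Sx lx; apply: ssdom.
(* From level [m] on, subtracting any element of [B] lowers the level strictly and keeps it
   nonnegative. *)
pose m := \max_(b <- B) `|l b|%N.
pose ss := ss0 ++ B ++ flatten [seq L j | j <- iota 0 m].
exists ss => [x|].
  rewrite !mem_cat => /or3P[/ss0S//|/BA[]//|/flatten_mapP[j _ xL]].
  by case: (LP j) => + _ => /(_ _ xL)[].
have [_ ssD] := (subsemigroupP _).1 (nat_span_subsemigroup ss).
have sub0 : nat_span ss0 `<=` nat_span ss.
  by apply: nat_span_sub => x xs; rewrite mem_cat xs.
move=> x Sx lx; have [n] := ubnP `|l x|%N.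
elim: n => // n IHn in x Sx lx * => lxn.
have [lx0|lx0] := eqVneq (l x) 0; first by apply: sub0; apply: S0.
have [b bB Sxb] : exists2 b, b \in B & S (x - b).
  by apply: Bdom; split=> //; rewrite lt_neqAle eq_sym lx0.
have [Sb lb] := BA _ bB.
have bm : (`|l b| <= m)%N by rewrite /m; apply: leq_bigmax_seq.
have [lem|ltm] := leqP m `|l x|%N.
  rewrite -(subrK b x); apply: ssD.
    by apply: IHn => //; rewrite lB; lia.
  by apply: nat_span_mem; rewrite !mem_cat bB orbT.
have [LS Ldom] := LP `|l x|%N.
have [|c cL Sxc] := Ldom x Sx; first by lia.
have [Sc lc] := LS _ cL.
rewrite -(subrK c x); apply: ssD.
  by apply/sub0/S0 => //; rewrite lB lc; lia.
apply: nat_span_mem; rewrite !mem_cat; apply/or3P/Or33.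
by apply/flatten_mapP; exists `|l x|%N; rewrite // mem_iota.
Qed.

(* Induction on the rank, as for rings: the part of S on which a coordinate l
   vanishes is again noetherian, and the parts l >= 0 and l <= 0 are finitely
   generated over it. *)
Lemma semigroup_noetherian_fg (ls : seq (V -> int)) S :
  (forall i, (i < size ls)%N -> {morph nth (fun=> 0) ls i : x y / x - y}) ->
  subsemigroup S -> semigroup_noetherian S ->
  (forall x, S x -> (forall i, (i < size ls)%N -> nth (fun=> 0) ls i x = 0) ->
    x = 0) ->
  fg_monoid S.
Proof.
elim: ls S => [|l ls IHl] S lsB sgS noS ls0; have /subsemigroupP[S0 SD] := sgS.
  exists [::]; apply/seteqP; split => x /=; last by move->.
  by move=> Sx; apply: ls0.
have lB : {morph l : x y / x - y} := lsB 0%N isT.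
have lD x y : l (x + y) = l x + l y.
  by rewrite -{2}(addrK y x) lB addrNK.
have [] := IHl [set x | S x /\ l x = 0].
- by move=> i; apply: (lsB i.+1).
- apply/subsemigroupP; split; first by rewrite /= (morph_sub0 lB).
  by move=> x y [Sx lx] [Sy ly]; split; [apply: SD | rewrite lD lx ly].
- move=> A AS; have [x /AS[]//|ss ssA ssdom] := noS A.
  exists ss => // x Ax; have [b bss Sxb] := ssdom x Ax.
  exists b => //; split=> //; rewrite lB.
  by have [_ ->] := AS _ Ax; have [_ ->] := AS _ (ssA _ bss).
- move=> x [Sx lx] lsx; apply: ls0 => // -[|i] //=; exact: lsx.
move=> ss0 eqss0.
have h0 x : S x -> l x = 0 -> nat_span ss0 x by rewrite -eqss0.
have h1 x : x \in ss0 -> S x by move/nat_span_mem; rewrite -eqss0 => -[].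
have [ss1 ss1S ss1P] := nat_span_half sgS noS lB h0 h1.
have [||ss2 ss2S ss2P] := @nat_span_half _ (fun x => - l x) ss0 sgS noS _ _ h1.
- by move=> x y; rewrite lB opprB opprK addrC.
- by move=> x Sx /eqP; rewrite oppr_eq0 => /eqP; apply: h0.
exists (ss1 ++ ss2); apply/seteqP; split; last first.
  by apply: nat_span_min => // x; rewrite mem_cat => /orP[/ss1S|/ss2S].
move=> x Sx; have [lx|lx] := leP 0 (l x).
  apply: nat_span_sub (ss1P _ Sx lx) => y ys; by rewrite mem_cat ys.
apply: nat_span_sub (ss2P _ Sx _) => [y ys|]; last by rewrite oppr_ge0 ltW.
by rewrite mem_cat ys orbT.
Qed.

End NatSpan.

(** * Presburger sets and quantifier elimination *)

Section Tame.
Variable V : zmodType.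
Implicit Types (X : set V) (f : V -> int) (fs : seq (V -> int)).

Definition affine f := forall x y, f (x + y) = f x + f y - f 0.

Lemma affineZB f x s (k : nat) :
  affine f -> f (x - s *+ k) = f x - k%:Z * (f s - f 0).
Proof.
move=> af; elim: k => [|k IHk]; first by rewrite mulr0n subr0 mul0r subr0.
have := af (x - s *+ k.+1) s.
by rewrite mulrSr opprD addrA subrK {}IHk => e; lia.
Qed.

Lemma affineZD f x s (k : nat) :
  affine f -> f (x + s *+ k) = f x + k%:Z * (f s - f 0).
Proof.
by move=> af; have := affineZB (x + s *+ k) s k af; rewrite addrK => ->; rewrite subrK.
Qed.

(* These are the sets definable without quantifiers in Presburger arithmetic. *)
Definition tame X := exists D fs, [/\ (0 < D)%N, forall f, f \in fs -> affine f
  & forall x y z, (forall f, f \in fs -> (0 <= f x) = (0 <= f y)) ->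
      x = y + z *+ D -> X x -> X y].

(** The defining condition is symmetric in [x] and [y], up to replacing [z] by [- z]. *)
Lemma tame_setC X : tame X -> tame (~` X).
Proof.
move=> [D [fs [D0 afs fsX]]]; exists D, fs; split=> // x y z sxy xy nXx Xy.
apply/nXx/(fsX y x (- z)) => // [f /sxy->//|].
by rewrite xy mulNrn addrK.
Qed.

Lemma tame_setU X Y : tame X -> tame Y -> tame (X `|` Y).
Proof.
move=> [D [fs [D0 afs fsX]]] [E [gs [E0 ags gsY]]].
exists (D * E)%N, (fs ++ gs); split=> [|f|x y z sxy xy].
- by rewrite muln_gt0 D0.
- by rewrite mem_cat => /orP[/afs|/ags].
move=> [Xx|Yx]; [left; apply: (fsX x y (z *+ E)) => //|
                 right; apply: (gsY x y (z *+ D)) => //].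
- by move=> f ffs; apply: sxy; rewrite mem_cat ffs.
- by rewrite -mulrnA mulnC.
- by move=> f ffs; apply: sxy; rewrite mem_cat ffs orbT.
- by rewrite -mulrnA.
Qed.

Lemma tame_set0 : tame set0.
Proof. by exists 1%N, [::]; split. Qed.

Lemma tame_setU_iter (X : nat -> set V) m :
  (forall i, (i < m)%N -> tame (X i)) -> tame [set x | exists2 i, (i < m)%N & X i x].
Proof.
elim: m => [_|m IHm tX].
  by have := tame_set0; congr tame; apply/seteqP; split=> // x [].
have := tame_setU (IHm (fun i im => tX i (ltnW im))) (tX m (ltnSn m)).
congr tame; apply/seteqP; split=> x /=.
  by case=> [[i im Xi]|Xm]; [exists i => //; apply: ltnW | exists m].
move=> [i]; rewrite ltnS leq_eqVlt => /orP[/eqP->|im] Xi; first by right.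
by left; exists i.
Qed.

(* Every integer a i either stays on its side of k or is moved to the same
   side of k'; k' is placed just above the image of the largest a j < k. *)
Lemma shift_threshold (I : Type) (P : set I) (a b : I -> int) (D : nat) (k : int) j0 :
  (0 < D)%N ->
  (forall i, P i -> exists c, a i = b i + c * D%:Z) ->
  (forall i j (d : nat), P i -> P j -> (d <= D)%N ->
    (d%:Z <= a i - a j) = (d%:Z <= b i - b j)) ->
  P j0 -> a j0 < k ->
  exists c, forall i, P i -> (k <= a i) = (k + c * D%:Z <= b i).
Proof.
move=> D0 abD abd Pj0 aj0.
(* [P] may be infinite; the largest [a j] below [k] exists because each better candidate decreases
   the positive integer [k - a j]. *)
have [j [Pj ajk jmax]] : exists j, [/\ P j, a j < k &
    forall i, P i -> a i < k -> a i <= a j].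
  have [n] := ubnP `|k - a j0|%N; elim: n => // n IHn in j0 Pj0 aj0 *.
  move=> kn; have [/existsNP[i /not_implyP[Pi /not_implyP[aik /negP]]]|] :=
    pselect (~ forall i, P i -> a i < k -> a i <= a j0).
    by rewrite -ltNge => lt_ij; apply: (IHn i) => //; lia.
  by move/contrapT => jmax; exists j0.
have [c abj] := abD _ Pj.
pose e := absz (k - a j - 1)%R.
have De : (e = e %/ D * D + e %% D)%N := divn_eq e D.
have ltD : (e %% D < D)%N by rewrite ltn_mod.
(* The new threshold is the integer among [b j + 1], ..., [b j + D] congruent to [k] modulo [D], so
   comparing distances up to [D] is enough. *)
exists (- c - (e %/ D)%N%:Z) => i Pi.
have ->: k + (- c - (e %/ D)%N%:Z) * D%:Z = b j + (e %% D).+1%:Z.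
  have : e%:Z = k - a j - 1 by rewrite /e; lia.
  by rewrite {1}De PoszD PoszM => h; lia.
have cmp := abd i j _ Pi Pj ltD.
have cmp0 := abd j i 0%N Pj Pi isT.
have [aik|kai] := ltP (a i) k.
  by have := jmax i Pi aik => lij; lia.
have : (e %% D).+1%:Z <= a i - a j.
  by have := leq_mod e D; rewrite /e in De ltD *; lia.
by rewrite cmp; lia.
Qed.

(* Eliminates k from X (x - s *+ k).  The sign of f (x - s *+ k) is constant in
   k if f has slope 0 along s; otherwise, up to a negation, it tells whether
   k <= floor (g x / E), where g is f (or - f - 1) rescaled to slope E.  So only
   the order and the mutual distances of these floors matter. *)
Section TameAddNat.
Variables (s : V) (fs : seq (V -> int)).
Let slope f := f s - f 0.
Let E := \prod_(f <- fs | slope f != 0) `|slope f|%N.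
Let scaled f x : int :=
  if 0 < slope f then f x * (E %/ `|slope f|)%N%:Z
  else (- f x - 1) * (E %/ `|slope f|)%N%:Z.
(** The constant [- E] has floor -1 after division by [E]: it supplies a value below every natural
    [k], and forces the number replacing [k] to be nonnegative. *)
Let thresholds : seq (V -> int) :=
  (fun=> - E%:Z) :: [seq scaled f | f <- fs & slope f != 0].

Lemma tame_lcm_gt0 : (0 < E)%N.
Proof. by rewrite prodn_cond_gt0// => f; rewrite absz_gt0. Qed.

Lemma tame_lcm_div f : f \in fs -> slope f != 0 ->
  (E %/ `|slope f| * `|slope f|)%N = E.
Proof.
move=> ffs sf; apply: divnK.
rewrite /E; elim: fs ffs => // g gs IHg; rewrite inE big_cons => /orP[/eqP<-|].
  by rewrite sf dvdn_mulr.
by move/IHg => dv; case: ifP => // _; rewrite dvdn_mull.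
Qed.

Lemma affine_thresholds : (forall f, f \in fs -> affine f) ->
  forall q, q \in thresholds -> affine q.
Proof.
move=> afs q; rewrite inE => /orP[/eqP->|/mapP[f]].
  by move=> x y; lia.
rewrite mem_filter => /andP[_ /afs af] ->.
by move=> x y; rewrite /scaled af; case: ifP => _; ring.
Qed.

Lemma scaled_threshold f x (k : nat) : affine f -> f \in fs -> slope f != 0 ->
  (0 <= f (x - s *+ k)) = (k%:Z <= (scaled f x %/ E%:Z)%Z) (+) (slope f < 0).
Proof.
move=> af ffs sf; rewrite affineZB// -/(slope f).
have E0 := tame_lcm_gt0; have Ef := tame_lcm_div ffs sf.
rewrite lez_divRL; last by lia.
rewrite /scaled; set u := (E %/ _)%N in Ef *.
have u0 : (0 < u)%N by case: u Ef E0 => // <-.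
rewrite -Ef PoszM mulrA.
case: ifP => sf0; have : `|slope f|%N%:Z = if 0 < slope f then slope f else - slope f.
- by rewrite sf0; lia.
- rewrite sf0 => ->; have -> : (slope f < 0) = false by rewrite ltNge ltW.
  rewrite addbF.
  have -> : k%:Z * u%:Z * slope f = k%:Z * slope f * u%:Z by ring.
  by rewrite ler_pM2r ?subr_ge0 //; lia.
- by rewrite sf0; lia.
- rewrite sf0 => ->.
  have -> : slope f < 0 by rewrite lt_neqAle sf leNgt sf0.
  have -> : k%:Z * u%:Z * - slope f = - (k%:Z * slope f) * u%:Z by ring.
  rewrite ler_pM2r; last by lia.
  by rewrite addbT; move: (k%:Z * slope f) (f x) => A B; lia.
Qed.

Lemma affine_residue q x z (D : nat) : affine q ->
  q (x + z *+ (E * D)) = q x + (q z - q 0) * D%:Z * E%:Z.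
Proof. by move=> aq; rewrite affineZD// PoszM; ring. Qed.

(** If [r] and [r'] are the remainders modulo [E], the floors differ by at least [d] exactly when
    [q x - q' x >= r - r' + d * E]. For [d <= D] these constants are bounded by [E * D.+2]. *)
Let comparisons (D : nat) : seq (V -> int) :=
  [seq (fun x => p.1 x - p.2 x - c) | p <- [seq (q, q') | q <- thresholds, q' <- thresholds],
    c <- [seq i%:Z - (E * D.+2)%N%:Z | i <- iota 0 (2 * (E * D.+2)).+1]].

Lemma mem_comparisons D q q' c : q \in thresholds -> q' \in thresholds ->
  (`|c| <= E * D.+2)%N -> (fun x => q x - q' x - c) \in comparisons D.
Proof.
move=> qt qt' cE; apply/allpairsP; exists ((q, q'), c); split=> //.
  by apply/allpairsP; exists (q, q').
apply/mapP; exists `|(c + (E * D.+2)%N%:Z)%R|%N; last by rewrite [LHS]/=; lia.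
by rewrite mem_iota; lia.
Qed.

Lemma affine_comparisons D : (forall f, f \in fs -> affine f) ->
  forall f, f \in comparisons D -> affine f.
Proof.
move=> afs f /allpairsP[[p c] [/allpairsP[[r r'] [rt rt' pE]] _ ->]].
have ar : affine r := affine_thresholds afs rt.
have ar' : affine r' := affine_thresholds afs rt'.
by have {}pE : p = (r, r') by []; move=> x y; rewrite pE /= ar ar'; lia.
Qed.

Lemma tame_add_nat_aux X D : (0 < D)%N -> (forall f, f \in fs -> affine f) ->
  (forall x y z, (forall f, f \in fs -> (0 <= f x) = (0 <= f y)) ->
      x = y + z *+ D -> X x -> X y) ->
  tame [set x | exists k, X (x - s *+ k)].
Proof.
move=> D0 afs fsX; have E0 := tame_lcm_gt0.
(* A translation by a multiple of [E * D] keeps the remainders of the thresholds modulo [E] and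
   moves their floors by multiples of [D]. *)
exists (E * D)%N, (fs ++ comparisons D); split=> [|f|x y z sxy xy].
- by rewrite muln_gt0 E0.
- by rewrite mem_cat => /orP[/afs|/affine_comparisons]//; apply.
move=> /= [k Xk].
pose a (q : V -> int) := (q x %/ E%:Z)%Z; pose b (q : V -> int) := (q y %/ E%:Z)%Z.
have En0 : E%:Z != 0 by lia.
have [] := @shift_threshold _ [set q | q \in thresholds] a b D k%:Z (fun=> - E%:Z) D0.
- move=> q /= /(affine_thresholds afs) aq; exists (q z - q 0).
  by rewrite /a xy affine_residue// addrC divzMDl// addrC.
- move=> q q' d /= qt qt' dD.
  have aq := affine_thresholds afs qt; have aq' := affine_thresholds afs qt'.
  pose r (p : V -> int) := (p y %% E%:Z)%Z.
  have rE p : affine p -> p x = a p * E%:Z + r p.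
    move=> ap; rewrite {1}(divz_eq (p x) E%:Z); congr (_ + _).
    by rewrite xy affine_residue// addrC modzMDl.
  have rE' p : p y = b p * E%:Z + r p by exact: divz_eq.
  have rlt p : 0 <= r p < E%:Z by rewrite modz_ge0//= ltz_pmod//; lia.
  have cE : (`|(r q - r q' + d%:Z * E%:Z)%R| <= E * D.+2)%N.
    have := rlt q; have := rlt q'; have : (d * E <= D * E)%N by rewrite leq_mul2r dD orbT.
    by rewrite !mulnS [(D * E)%N]mulnC; lia.
  have /sxy : (fun x => q x - q' x - (r q - r q' + d%:Z * E%:Z)) \in fs ++ comparisons D.
    by rewrite mem_cat mem_comparisons ?orbT.
  rewrite (rE q aq) (rE q' aq') (rE' q) (rE' q').
  have shuffle (A B : int) : A * E%:Z + r q - (B * E%:Z + r q') - (r q - r q' + d%:Z * E%:Z)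
    = (A - B - d%:Z) * E%:Z by ring.
  by rewrite !shuffle !pmulr_lge0 ?subr_ge0//; lia.
- by rewrite /= mem_head.
- by rewrite /a -mulN1r mulzK//; lia.
move=> c kc.
have : 0 <= k%:Z + c * D%:Z.
  have := kc _ (mem_head _ _); rewrite /a /b -mulN1r !mulzK//; lia.
case k'E : (k%:Z + c * D%:Z) => [k'|//] _; exists k'.
(* Since [k'] is [k + c * D], the change of coefficient is absorbed, like that of [x], in a multiple
   of [D]. *)
apply: (fsX (x - s *+ k) (y - s *+ k') (z *+ E + s *~ c)) => //.
- move=> f ffs; have af := afs f ffs.
  have [sf|sf] := eqVneq (slope f) 0.
    by rewrite !affineZB// -/(slope f) sf !mulr0 !subr0 sxy// mem_cat ffs.
  rewrite !scaled_threshold//; congr addb.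
  have /kc -> : scaled f \in thresholds.
    by rewrite inE; apply/orP; right; apply/mapP; exists f; rewrite ?mem_filter ?sf.
  by rewrite k'E.
- have -> : s *+ k' = s *+ k + s *~ c *+ D.
    by rewrite !pmulrn -k'E mulrzDr mulrzA.
  by rewrite mulrnDl -mulrnA opprD [y + (_ - _)]addrA addrACA addNr addr0 addrAC xy.
Qed.
End TameAddNat.

Lemma tame_add_nat (s : V) X : tame X -> tame [set x | exists k, X (x - s *+ k)].
Proof. by move=> [D [fs [D0 afs fsX]]]; apply: (tame_add_nat_aux s D0 afs fsX). Qed.

Lemma tame_nat_span (w : V) ss : tame [set w] ->
  tame [set x | nat_span ss (x - w)].
Proof.
move=> tw; elim: ss => [|s ss IHs] /=.
  suff -> : [set x | x - w = 0] = [set w] by [].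
  by apply/seteqP; split=> x /=; [move/eqP; rewrite subr_eq0 => /eqP|move->; rewrite subrr].
have := tame_add_nat s IHs; congr tame; apply/seteqP.
by split=> x /= [k xk]; exists k; rewrite addrAC.
Qed.
End Tame.

(** * Dickson's lemma and natural combinations *)

Lemma nondecreasing_subsequence (u : nat -> nat) :
  exists s : nat -> nat, {homo s : i j / (i < j)%N} /\
    {homo u \o s : i j / (i <= j)%N}.
Proof.
have /choice[g gP] : forall m, exists k, (m <= k)%N /\
    forall j, (m <= j)%N -> (u k <= u j)%N.
  move=> m; have ex : exists v, `[< exists2 k, (m <= k)%N & u k = v >].
    by exists (u m); apply/asboolP; exists m.
  case: (ex_minnP ex) => v /asboolP[k mk <-] vmin; exists k; split=> // j mj.
  by apply: vmin; apply/asboolP; exists j.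
(* Each term minimizes [u] on the tail after the previous one, and minima of shrinking tails do not
   decrease. *)
pose s := fix s n := if n is n'.+1 then g (s n').+1 else g 0%N.
have sS n : (s n < s n.+1)%N by have [] := gP (s n).+1.
have smono : {homo s : i j / (i < j)%N} by apply: homo_ltn => //; exact: ltn_trans.
exists s; split=> // i j; rewrite leq_eqVlt => /orP[/eqP->//|ij] /=.
case: i => [|i] in ij *; first by apply: (gP 0%N).2.
by apply: (gP (s i).+1).2; apply: leq_trans (sS i) _; apply/ltnW/smono.
Qed.

Lemma dickson (us : seq (nat -> nat)) :
  exists s : nat -> nat, {homo s : i j / (i < j)%N} /\
    forall u, u \in us -> {homo u \o s : i j / (i <= j)%N}.
Proof.
elim: us => [|u us [s [smono sus]]]; first by exists id; split.
have [r [rmono ur]] := nondecreasing_subsequence (u \o s).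
exists (s \o r); split=> [i j /rmono/smono//|v].
have rmonow : {homo r : i j / (i <= j)%N} by apply: ltnW_homo.
by rewrite inE => /orP[/eqP->//|/sus vs i j /rmonow/vs].
Qed.

Section Combinations.
Variable V : zmodType.
Implicit Types cs : seq V.

Definition comb cs (a : nat -> nat) : V := \sum_(i < size cs) cs`_i *+ a i.

Lemma nat_span_comb cs a : nat_span cs (comb cs a).
Proof.
have /subsemigroupP[S0 SD] := nat_span_subsemigroup cs.
apply: (big_ind (nat_span cs)) => // i _.
apply: subsemigroupMn; first exact: nat_span_subsemigroup.
exact/nat_span_mem/mem_nth.
Qed.

Lemma nat_spanP cs x : nat_span cs x -> exists a, x = comb cs a.
Proof.
elim: cs x => [|c cs IHc] x /=; first by move=> ->; exists (fun=> 0%N); rewrite /comb big_ord0.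
move=> [k /IHc[a xk]]; exists (fun i => if i is i'.+1 then a i' else k).
by rewrite /comb big_ord_recl /= -[LHS](subrK (c *+ k)) xk addrC.
Qed.

Lemma combB cs a b : (forall i, (i < size cs)%N -> (a i <= b i)%N) ->
  comb cs b - comb cs a = comb cs (fun i => b i - a i)%N.
Proof.
move=> ab; rewrite /comb -sumrB; apply: eq_bigr => i _.
by rewrite mulrnBr// ab.
Qed.

Lemma finite_nat_span_torsion cs :
  (forall c, c \in cs -> torsion c) -> finite_set (nat_span cs).
Proof.
elim: cs => [|c cs IHc] tcs /=; first exact: finite_set1.
have [n n0 cn] := tcs c (mem_head _ _).
apply: (@sub_finite_set _ _
  (\bigcup_(k in `I_n) [set y + c *+ k | y in nat_span cs])).
  move=> x [k xk]; exists (k %% n)%N; first by rewrite /= ltn_mod.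
  exists (x - c *+ k) => //; rewrite {1}(divn_eq k n) mulrnDr mulnC mulrnA cn.
  by rewrite mul0rn add0r subrK.
apply: bigcup_finite; first exact: finite_II.
move=> k _; apply: finite_image; apply: IHc => d dcs; apply: tcs.
by rewrite inE dcs orbT.
Qed.
End Combinations.

(** * Tame sets in a lattice mapping onto [G] *)

Section Lattice.
Variable N : nat.
Notation V := 'rV[int]_N.

Lemma rV_fg_monoid (S : set V) :
  subsemigroup S -> semigroup_noetherian S -> fg_monoid S.
Proof.
move=> sgS noS.
pose coord (j : 'I_N) := fun x : V => x 0 j.
have nthE i (iN : (i < size (enum 'I_N))%N) : 
    nth (fun=> 0) [seq coord j | j <- enum 'I_N] i = 
    coord (Ordinal (etrans (esym (congr1 (leq i.+1) (size_enum_ord N))) iN)).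
  set o := Ordinal _; rewrite (nth_map o)//; congr coord.
  by apply/val_inj; rewrite /= nth_enum_ord// -[X in (_ < X)%N](size_enum_ord N).
apply: (@semigroup_noetherian_fg _ [seq coord j | j <- enum 'I_N]) => //.
  by rewrite size_map => i iN x y; rewrite nthE /coord !mxE.
rewrite size_map => x Sx x0; apply/rowP => j.
have jN : (j < size (enum 'I_N))%N by rewrite size_enum_ord.
rewrite [RHS]mxE -[RHS](x0 j jN) nthE /coord.
by congr (x 0 _); apply/val_inj.
Qed.

(** Equality is two opposite inequalities per coordinate; the modulus 1 imposes no congruence. *)
Lemma tame_set1 (w : V) : tame [set w].
Proof.
exists 1%N, ([seq (fun x : V => x 0 j - w 0 j) | j <- enum 'I_N] ++
             [seq (fun x : V => w 0 j - x 0 j) | j <- enum 'I_N]).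
split=> // [f|x y z sxy _ /= xw].
  by rewrite mem_cat => /orP[]/mapP[j _ ->] x y; rewrite !mxE; ring.
apply/rowP => j.
have := sxy (fun x : V => x 0 j - w 0 j); rewrite mem_cat map_f ?mem_enum//.
have := sxy (fun x : V => w 0 j - x 0 j); rewrite mem_cat orbC map_f ?mem_enum//.
by rewrite xw subrr => /(_ isT) h1 /(_ isT) h2; lia.
Qed.

Variables (G : zmodType) (pi : V -> G).
Hypothesis piD : {morph pi : x y / x + y}.
Hypothesis pi_surj : forall g, exists x, pi x = g.

Lemma pi0 : pi 0 = 0.
Proof. by apply: (addrI (pi 0)); rewrite -piD !addr0. Qed.

Lemma piN : {morph pi : x / - x}.
Proof. by move=> x; apply: (addrI (pi x)); rewrite -piD !subrr pi0. Qed.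

Lemma piMn x k : pi (x *+ k) = pi x *+ k.
Proof.
by elim: k => [|k IHk]; rewrite ?mulr0n ?pi0// !mulrS piD IHk.
Qed.

Lemma pi_nat_span cs x : nat_span cs x -> nat_span (map pi cs) (pi x).
Proof.
elim: cs x => [x ->|c cs IHc x [k xk]] /=; first exact: pi0.
by exists k; rewrite -piMn -piN -piD; apply: IHc.
Qed.

(* The preimage of the torsion subgroup is finitely generated, as a subgroup of
   a lattice. *)
Lemma finite_torsion : finite_set (@torsion G).
Proof.
pose E : set V := [set x | torsion (pi x)].
have EB x y : E x -> E y -> E (x - y).
  move=> [n n0 xn] [m m0 ym]; exists (n * m)%N; first by rewrite muln_gt0 n0.
  by rewrite piD piN mulrnDl mulNrn mulrnA xn mulnC mulrnA ym !mul0rn subrr.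
have E0 : E 0 by exists 1%N; rewrite // pi0 mul0rn.
have [||es Ees] := @rV_fg_monoid E.
- apply/subsemigroupP; split=> // x y Ex Ey; rewrite -[y]opprK.
  by apply: (EB _ _ Ex); rewrite -sub0r; apply: EB.
(* [E] is a group, so any single element of [A] dominates all the others. *)
- move=> A AE; have [[a Aa]|nA] := pselect (exists a, A a).
    exists [:: a] => [b|x Ax]; first by rewrite inE => /eqP->.
    by exists a; rewrite ?mem_head//; apply: EB; apply: AE.
  by exists [::] => // x Ax; case: nA; exists x.
apply: (@sub_finite_set _ _ (nat_span (map pi es))).
  move=> g tg; have [x xg] := pi_surj g.
  by rewrite -xg; apply: pi_nat_span; rewrite -Ees /E /= xg.
apply: finite_nat_span_torsion => _ /mapP[e ees ->].
by have := nat_span_mem ees; rewrite -Ees.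
Qed.

Lemma infinite_sequence (T : Type) (A : set T) : infinite_set A ->
  exists2 g : nat -> T, injective g & forall n, A (g n).
Proof.
move=> /infiniteP/card_leP[f]; exists (fun n => set_val (f (to_setT n))) => [i j|n].
  by move=> /val_inj fij; apply: (congr1 set_val (inj (mem_set I) (mem_set I) fij)).
exact: set_valP.
Qed.

(* Along a subsequence y given by Dickson's lemma the signs of the f (y n) and
   the residues of y n are constant while the |f (y n)| grow, so the whole ray
   from y 0 through y l stays in X. *)
Lemma tame_line (cs : seq V) (t : V) (X : set V) : tame X ->
  infinite_set [set pi x | x in [set x | X x /\ nat_span cs (x - t)]] ->
  exists c d, [/\ nat_span cs c, ~ torsion (pi c), nat_span cs (d - t) &
    forall k, X (d + c *+ k)].
Proof.
move=> [D [fs [D0 afs fsX]]] /infinite_sequence[g g_inj gX].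
have /choice[x xP] : forall n, exists x, [/\ pi x = g n, X x & nat_span cs (x - t)].
  by move=> n; have [x [Xx xcs] <-] := gX n; exists x.
have /choice[a aP] : forall n, exists b, x n - t = comb cs b.
  by move=> n; have [_ _ /nat_spanP] := xP n.
pose co (v : V) j : int := v 0 j.
pose res (j : 'I_N) n := `|(co (x n) j %% D%:Z)%Z|%N.
have res_lt j n : (res j n <= D)%N by rewrite /res; lia.
(* A quantity listed together with its complement, as the truth values and the residues are, becomes
   constant. Monotone coefficients [a n i] put the differences [p l] into [nat_span cs]. *)
pose us := [seq (fun n => a n i) | i <- iota 0 (size cs)] ++
  [seq (fun n => `|f (x n)|%N) | f : V -> int <- fs] ++
  [seq (fun n => nat_of_bool (0 <= f (x n))) | f : V -> int <- fs] ++
  [seq (fun n => nat_of_bool (~~ (0 <= f (x n)))) | f : V -> int <- fs] ++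
  [seq res j | j <- enum 'I_N] ++
  [seq (fun n => D - res j n)%N | j <- enum 'I_N].
have [s [s_mono sP]] := dickson us.
have s0 l : (s 0 <= s l)%N by case: l => // l; apply/ltnW/s_mono.
pose y n := x (s n); pose p n := y n - y 0%N.
have pcs l : nat_span cs (p l).
  have -> : p l = (y l - t) - (y 0%N - t) by rewrite /p opprB addrA subrK.
  rewrite /y !aP combB; first exact: nat_span_comb.
  move=> i ics; have := sP (fun n => a n i) _ 0%N l isT; apply.
  by rewrite mem_cat (map_f (fun i n => a n i))// mem_iota.
have ysign (f : V -> int) l : f \in fs -> (0 <= f (y l)) = (0 <= f (y 0%N)).
  move=> ffs.
  have := sP (fun n => nat_of_bool (0 <= f (x n))) _ 0%N l isT.
  rewrite !mem_cat (map_f (fun (f : V -> int) n => nat_of_bool (0 <= f (x n))))// !orbT => /(_ isT).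
  have := sP (fun n => nat_of_bool (~~ (0 <= f (x n)))) _ 0%N l isT.
  rewrite !mem_cat (map_f (fun (f : V -> int) n => nat_of_bool (~~ (0 <= f (x n)))))// !orbT.
  by move=> /(_ isT) /=; rewrite -/(y l) -/(y 0%N); do 2 case: (0 <= f _).
have yabs (f : V -> int) l : f \in fs -> (`|f (y 0%N)| <= `|f (y l)|)%N.
  move=> ffs; have := sP (fun n => `|f (x n)|%N) _ 0%N l isT; apply.
  by rewrite !mem_cat (map_f (fun (f : V -> int) n => `|f (x n)|%N))// !orbT.
have pD l : exists z, p l = z *+ D.
  exists (\row_j (co (p l) j %/ D%:Z)%Z); apply/rowP => j.
  have : res j (s l) = res j (s 0%N).
    have := sP (res j) _ 0%N l isT.
    rewrite !mem_cat map_f ?mem_enum// !orbT => /(_ isT).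
    have := sP (fun n => D - res j n)%N _ 0%N l isT.
    rewrite !mem_cat (map_f (fun j n => D - res j n)%N) ?mem_enum// !orbT => /(_ isT).
    by rewrite /=; have := res_lt j (s l); have := res_lt j (s 0%N); lia.
  move=> rjl; have coB : co (p l) j = co (y l) j - co (y 0%N) j by rewrite /co !mxE.
  have /eqP : (co (y l) j = co (y 0%N) j %[mod D%:Z])%Z.
    by move: rjl; rewrite /res -/(y l) -/(y 0%N); lia.
  rewrite eqz_mod_dvd -coB => dv.
  by rewrite mulmxnE [in RHS]mxE -mulr_natr natz divzK.
(* Otherwise the distinct elements [pi (y l)] would all lie in one translate of the finite torsion
   subgroup. *)
have [l nl] : exists l, ~ torsion (pi (p l)).
  apply/existsNP => tp; have : finite_set [set: nat]; last exact: infinite_nat.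
  have -> : [set: nat] = (fun l => pi (p l)) @^-1` @torsion G.
    by apply/seteqP; split=> // l _; exact: tp.
  apply: finite_preimage finite_torsion => l m _ _.
  have pig n : pi (p n) = g (s n) - g (s 0%N).
    by rewrite piD piN; have [-> _ _] := xP (s n); have [-> _ _] := xP (s 0%N).
  rewrite !pig => /addIr/g_inj slm.
  have [ml|lm|//] := ltngtP m l; [have := s_mono _ _ ml | have := s_mono _ _ lm];
    by rewrite slm ltnn.
exists (p l), (y 0%N); split=> // [|k].
  by have [] := xP (s 0%N).
have [z pz] := pD l.
have [_ Xy _] := xP (s 0%N).
apply: (fsX (y 0%N) _ (- z *+ k)) => //; last first.
  by rewrite pz !mulNrn -!mulrnA mulnC addrK.
(* On the ray, [f] is affine in [k] with slope [f (y l) - f (y 0)]. As [f (y l)] is on the same side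
   of 0 as [f (y 0)] and at least as large in absolute value, the sign never changes. *)
move=> f ffs; rewrite affineZD; last exact: afs.
have -> : f (p l) - f 0 = f (y l) - f (y 0%N).
  have := afs f ffs (p l) (y 0%N); rewrite subrK => ->; lia.
have := ysign f l ffs; have := yabs f l ffs.
by have [|] := leP 0 (f (y 0%N)); nia.
Qed.

Lemma nat_span_lift cs g :
  nat_span (map pi cs) g -> exists2 x, nat_span cs x & pi x = g.
Proof.
elim: cs g => [_ ->|c cs IHc g [k /IHc[x xcs xg]]] /=; first by exists 0; rewrite ?pi0.
exists (x + c *+ k); first by exists k; rewrite addrK.
by rewrite piD piMn xg subrK.
Qed.

Lemma finitely_generated_nat_span (S : set G) :
  finitely_generated (@subsemigroup G) S -> exists ss, S = nat_span ss.
Proof.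
move=> [B /finite_seqP[ss ->] ->]; exists ss; apply/seteqP; split.
  apply: smallest_sub; first exact: nat_span_subsemigroup.
  by move=> x; apply: nat_span_mem.
move=> x xs A [sgA ssA]; exact: nat_span_min xs.
Qed.

(** One of the finitely many translates [S + t] that make up [T] leaves [W] infinitely often;
    [tame_line] applies to its lift. *)
Lemma line_outside (S T W : set G) :
  finitely_generated (@subsemigroup G) S -> fg_semigroup_module S T ->
  tame (pi @^-1` W) -> infinite_set (T `\` W) ->
  exists c d, [/\ S c, ~ torsion c, T d & forall k, ~ W (c *+ k + d)].
Proof.
move=> /finitely_generated_nat_span[ss ->] [_ [B [finB _ TE]]] tW infT.
have [t Bt inft] : exists2 t, B t & infinite_set ([set s + t | s in nat_span ss] `\` W).
  apply: contrapT => fint; apply: infT; rewrite TE setD_bigcupl.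
  apply: bigcup_finite => // t Bt; apply: contrapT => inft.
  by apply: fint; exists t.
have /choice[lift liftK] := pi_surj.
pose cs := map lift ss.
have csE : map pi cs = ss by rewrite -map_comp -[RHS]map_id; apply: eq_map.
have [||c [d [ccs nc dcs dX]]] := @tame_line cs (lift t) (~` (pi @^-1` W)).
- exact: tame_setC.
- apply: sub_infinite_set inft => _ [[s + <-] nW].
  rewrite -csE => /nat_span_lift[x xcs xs]; exists (x + lift t); last first.
    by rewrite piD liftK xs.
  by split; [rewrite /= piD liftK xs | rewrite addrK].
exists (pi c), (pi d); split=> //; first by rewrite -csE; apply: pi_nat_span.
  rewrite TE; exists t => //; exists (pi (d - lift t)).
    by rewrite -csE; apply: pi_nat_span.
  by rewrite piD piN liftK subrK.
by move=> k; have := dX k; rewrite /= piD piMn addrC.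
Qed.

(** [A] is an ideal of [S], hence a finite union of translates of [S], and the preimage of [S] in
    the lattice is again noetherian, hence finitely generated. *)
Lemma tame_translate (S A : set G) (g : G) :
  subsemigroup S -> semigroup_noetherian S -> A `<=` S ->
  (forall x y, A x -> S y -> A (x + y)) ->
  tame (pi @^-1` [set t | A (t - g)]).
Proof.
move=> sgS noS AS AD; have /subsemigroupP[S0 SD] := sgS.
have /choice[lift liftK] := pi_surj.
have [||ss Sss] := @rV_fg_monoid (pi @^-1` S).
- by apply/subsemigroupP; split=> [|x y] /=; rewrite ?pi0// piD; apply: SD.
- move=> C CS; have [_ [x /CS Sx <-] //|bs bsC bsdom] := noS [set pi x | x in C].
  exists [seq xget 0 [set x | C x /\ pi x = b] | b <- bs] => [x /mapP[b /bsC[c Cc cb] ->]|x Cx].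
    by case: xgetP => [y _ []//|/(_ c) []].
  have [|b bbs Sxb] := bsdom (pi x); first by exists x.
  exists (xget 0 [set x | C x /\ pi x = b]); first exact: map_f.
  have [c Cc cb] := bsC _ bbs.
  by case: xgetP => [y _ [_ yb]|/(_ c) []//]; rewrite /= piD piN yb.
have [bs bsA bsdom] := noS A AS.
have -> : pi @^-1` [set t | A (t - g)] =
    \big[setU/set0]_(b <- bs) [set x | nat_span ss (x - lift (b + g))].
  apply/seteqP; split=> x; rewrite -bigcup_seq /=.
    move=> /bsdom[b bbs Sb]; exists b => //.
    by rewrite /= -Sss /= piD piN liftK opprD addrA addrAC.
  move=> [b /bsA Ab /=]; rewrite -Sss /= piD piN liftK => Sx.
  by have := AD _ _ Ab Sx; rewrite addrC opprD addrA addrAC subrK.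
elim: bs {bsA bsdom} => [|b bs IHb]; first by rewrite big_nil; apply: tame_set0.
rewrite big_cons; apply: tame_setU => //.
exact/tame_nat_span/tame_set1.
Qed.
End Lattice.

Lemma lattice_cover (G : zmodType) : finitely_generated (@subgroup G) [set: G] ->
  exists N (pi : 'rV[int]_N -> G), {morph pi : x y / x + y} /\ forall g, exists x, pi x = g.
Proof.
move=> [B /finite_seqP[bs ->] Gbs].
pose pi (x : 'rV[int]_(size bs)) := \sum_(j < size bs) bs`_j *~ x 0 j.
have piB : {morph pi : x y / x - y}.
  by move=> x y; rewrite -sumrB; apply: eq_bigr => j _; rewrite !mxE mulrzBr.
exists (size bs), pi; split=> [x y|g].
  by rewrite -big_split; apply: eq_bigr => j _; rewrite !mxE mulrzDr.
have : [set: G] g by [].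
rewrite Gbs; apply: (@smallest_sub _ _ _ [set g | exists x, pi x = g]).
  split.
    by rewrite inE; exists 0; rewrite /pi big1// => j _; rewrite mxE mulr0z.
  by move=> x y; rewrite !inE => -[u <-] [v <-]; exists (u - v); exact: piB.
move=> b /= /[dup] bbs; rewrite -index_mem => ib.
exists (delta_mx 0 (Ordinal ib)); rewrite /pi (bigD1 (Ordinal ib))//= big1 ?addr0.
  by rewrite mxE !eqxx mulr1z nth_index.
by move=> j nj; rewrite mxE (negPf nj) andbF mulr0z.
Qed.

(** * Submodules and the maximum condition *)

Lemma submoduleP (R : nzRingType) (V : lmodType R) (N : set V) :
  submodule N <-> N 0 /\ forall a u v, N u -> N v -> N (a *: u + v).
Proof.
split=> -[N0 NL]; split.
- by move: N0; rewrite inE.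
- by move=> a u v Nu Nv; move: (NL a u v); rewrite !inE; apply.
- by rewrite inE.
- by move=> a u v; rewrite !inE; apply: NL.
Qed.

Section Submodule.
Variables (R : nzRingType) (V : lmodType R) (N : set V).
Hypothesis smN : submodule N.

Lemma submodule0 : N 0. Proof. by have /submoduleP[] := smN. Qed.

Lemma submoduleD x y : N x -> N y -> N (x + y).
Proof. by have /submoduleP[_ NL] := smN; move=> Nx /(NL 1 _ _ Nx); rewrite scale1r. Qed.

Lemma submoduleZ a x : N x -> N (a *: x).
Proof.
have /submoduleP[_ NL] := smN.
by move=> /(NL a)/(_ submodule0); rewrite addr0.
Qed.

Lemma submodule_sum (I : Type) (s : seq I) (F : I -> V) :
  (forall i, N (F i)) -> N (\sum_(i <- s) F i).
Proof.
move=> NF; apply: (big_ind N) => //; first exact: submodule0.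
exact: submoduleD.
Qed.
End Submodule.

Lemma noetherian_max (R : comNzRingType) (F : set (set R^o)) :
  noetherian R -> (forall I, F I -> submodule I) -> F !=set0 ->
  exists2 I, F I & forall J, F J -> I `<=` J -> J = I.
Proof.
move=> noR smF [I0 FI0]; apply: contrapT => noMax.
have /choice[g gP] : forall I, exists J, F I -> [/\ F J, I `<=` J & J <> I].
  move=> I; have [FI|nFI] := pselect (F I); last by exists I.
  apply: contrapT => noJ; apply: noMax; exists I => // J FJ IJ.
  by apply: contrapT => nJI; apply: noJ; exists J.
pose u n := iter n g I0.
have Fu n : F (u n) by elim: n => //= n /gP[].
have uS n : u n `<=` u n.+1 by have [] := gP _ (Fu n).
have u_mono m n : (m <= n)%N -> u m `<=` u n.
  by elim: n => [|n IHn]; rewrite leq_eqVlt => /orP[/eqP->//|]// /IHn h x /h/uS.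
have [|B /finite_seqP[bs ->] UE] := noR (\bigcup_n u n).
  apply/submoduleP; split; first by exists 0%N => //; apply: (submodule0 (smF _ (Fu 0%N))).
  move=> a x y [m _ xm] [n _ yn]; exists (maxn m n) => //.
  have sm := smF _ (Fu (maxn m n)).
  apply: (submoduleD sm); last exact: u_mono (leq_maxr _ _) _ yn.
  by apply: (submoduleZ sm); apply: u_mono (leq_maxl _ _) _ xm.
have /choice[nb nbP] : forall b, exists n, b \in bs -> u n b.
  move=> b; have [bbs|] := boolP (b \in bs); last by exists 0%N.
  have : (\bigcup_n u n) b by rewrite UE; apply: sub_gen_smallest.
  by move=> [n _ un]; exists n.
pose n := \max_(b <- bs) nb b.
have [_ _ []] := gP _ (Fu n); apply/seteqP; split; last exact: uS.
apply: (@subset_trans _ (\bigcup_n u n)); first by move=> x ux; exists n.+1.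
rewrite UE; apply: smallest_sub; first exact: smF.
move=> b /= bbs; apply: u_mono (nbP b bbs).
exact: leq_bigmax_seq.
Qed.

(** * Homogeneous components *)

Section DirectSum.
Variables (G : choiceType) (V : zmodType) (V_ : G -> set V).
Hypothesis dsV : direct_sum V_.

Lemma fsum_setT_seq (f : G -> V) (s : seq G) : uniq s ->
  (forall g, g \notin s -> f g = 0) -> \sum_(g \in setT) f g = \sum_(g <- s) f g.
Proof.
move=> us fs; rewrite (fsbigE s)//; last by move=> g _; apply: fs.
by apply: eq_bigl => g; rewrite in_setT.
Qed.

Lemma subgroupP g : V_ g 0 /\ forall x y, V_ g x -> V_ g y -> V_ g (x - y).
Proof.
have [/(_ g)[g0 gB] _] := dsV; split; first by move: g0; rewrite inE.
by move=> x y xg yg; move: (gB x y); rewrite !inE; apply.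
Qed.

Lemma component0 g : V_ g 0. Proof. by case: (subgroupP g). Qed.

Lemma component_addr g x y : V_ g x -> V_ g y -> V_ g (x + y).
Proof.
have [g0 gB] := subgroupP g; move=> xg yg; rewrite -[y]opprK; apply: (gB _ _ xg).
by rewrite -sub0r; apply: gB.
Qed.

(** Additivity and the values on homogeneous elements come from uniqueness, packaged as [pE]: any
    exhibited decomposition is the chosen one. *)
Lemma direct_sum_proj : exists p : V -> G -> V,
  [/\ forall v g, V_ g (p v g), forall v w g, p (v + w) g = p v g + p w g,
      forall g v, V_ g v -> forall h, p v h = if h == g then v else 0
    & forall v, exists2 s : seq G, forall g, g \notin s -> p v g = 0
        & v = \sum_(g <- s) p v g].
Proof.
have [_ /choice[p pP]] := dsV.
have supp v : exists s : seq G, uniq s /\ forall g, g \notin s -> p v g = 0.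
  have [[_ /finite_seqP[s sE] _] _] := pP v.
  exists (undup s); split=> [|g]; first exact: undup_uniq.
  rewrite mem_undup => gs; apply/eqP; apply: contraNT gs => pg.
  by have : [set g | p v g != 0] g by []; rewrite sE.
have pE v f s : uniq s -> (forall g, V_ g (f g)) -> (forall g, g \notin s -> f g = 0) ->
    v = \sum_(g <- s) f g -> p v = f.
  move=> us Vf fs vE; have [_] := pP v; apply; split=> //.
    apply: (@sub_finite_set _ _ [set` s]); last exact: finite_seq.
    by move=> g /=; apply: contraNT => /fs->.
  by rewrite (fsum_setT_seq us fs).
have pV v g : V_ g (p v g) by have [[]] := pP v.
have psum v s : uniq s -> (forall g, g \notin s -> p v g = 0) -> v = \sum_(g <- s) p v g.
  by move=> us ps; have [[_ _ vE] _] := pP v; rewrite -(fsum_setT_seq us ps).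
exists p; split=> //.
- move=> v w g; have [s [us ps]] := supp v; have [t [ut pt]] := supp w.
  pose r := undup (s ++ t); have ur : uniq r by exact: undup_uniq.
  have nr h : h \notin r -> p v h = 0 /\ p w h = 0.
    by rewrite mem_undup mem_cat negb_or => /andP[/ps-> /pt->].
  rewrite (pE (v + w) (fun g => p v g + p w g) r)//.
  + by move=> h; apply: component_addr.
  + by move=> h /nr[-> ->]; rewrite addr0.
  + by rewrite big_split/= -!psum// => h /nr[].
- move=> g v vg h; rewrite (pE v (fun h => if h == g then v else 0) [:: g])//.
  + by move=> k; case: eqP => [->//|_]; apply: component0.
  + by move=> k; rewrite inE => /negPf->.
  + by rewrite big_seq1 eqxx.
- by move=> v; have [s [us ps]] := supp v; exists s => //; apply: psum.
Qed.

Definition component : V -> G -> V := projT1 (cid direct_sum_proj).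

Lemma component_in v g : V_ g (component v g).
Proof. by rewrite /component; case: cid => p []. Qed.

Lemma componentD v w g : component (v + w) g = component v g + component w g.
Proof. by rewrite /component; case: cid => p []. Qed.

Lemma component_homog g v h : V_ g v -> component v h = if h == g then v else 0.
Proof. by move=> vg; rewrite /component; case: cid => p [_ _ ph _] /=; apply: ph. Qed.

Lemma component_support v : exists2 s : seq G,
  forall g, g \notin s -> component v g = 0 & v = \sum_(g <- s) component v g.
Proof. by rewrite /component; case: cid => p []. Qed.

Lemma component_0 g : component 0 g = 0.
Proof. by rewrite (component_homog g (component0 g)) eqxx. Qed.

Lemma component_sum (I : Type) (s : seq I) (F : I -> V) g :
  component (\sum_(i <- s) F i) g = \sum_(i <- s) component (F i) g.
Proof.
by apply: (big_morph (component^~ g)) => [x y|]; rewrite ?componentD ?component_0.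
Qed.

Lemma in_sum (I : Type) (s : seq I) (F : I -> V) g :
  (forall i, V_ g (F i)) -> V_ g (\sum_(i <- s) F i).
Proof.
by move=> VF; apply: (big_ind (V_ g)) => //; [apply: component0|apply: component_addr].
Qed.
End DirectSum.

(** * Linear algebra modulo a submodule *)

Section LinearIndependence.
Variables (K : fieldType) (R : comAlgType K) (V : lmodType R).
Implicit Types (W B : set V) (v : nat -> V) (a : nat -> K).

Definition lin_comb v a n : V := \sum_(i < n) (a i)%:A *: v i.

(** Independence in the quotient by [B], without forming it. Families are indexed by [nat] and only
    the first [n] entries count, so [n] can vary freely. *)
Definition free_mod B v n :=
  forall a, B (lin_comb v a n) -> forall i, (i < n)%N -> a i = 0.

Definition spans_mod W B v n := forall x, W x -> exists a, B (x - lin_comb v a n).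

Definition indep_mod W B n :=
  exists2 v, forall i, (i < n)%N -> W (v i) & free_mod B v n.

Definition span_mod W B n := exists k v,
  [/\ (k <= n)%N, forall i, (i < k)%N -> W (v i) & spans_mod W B v k].

Lemma lin_combS v a n : lin_comb v a n.+1 = lin_comb v a n + (a n)%:A *: v n.
Proof. by rewrite /lin_comb big_ord_recr. Qed.

Lemma eq_lin_comb v v' a a' n : (forall i, (i < n)%N -> v i = v' i) ->
  (forall i, (i < n)%N -> a i = a' i) -> lin_comb v a n = lin_comb v' a' n.
Proof. by move=> vv aa; apply: eq_bigr => i _; rewrite vv// aa. Qed.

Lemma lin_comb_cat v w a b k l :
  lin_comb (fun i => if (i < k)%N then v i else w (i - k)%N)
    (fun i => if (i < k)%N then a i else b (i - k)%N) (k + l) =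
  lin_comb v a k + lin_comb w b l.
Proof.
rewrite /lin_comb big_split_ord /=; congr (_ + _); apply: eq_bigr => i _.
  by rewrite ltn_ord.
by rewrite ltnNge leq_addr addKn.
Qed.

Lemma lin_combZ v a n c : lin_comb v (fun i => c * a i) n = c%:A *: lin_comb v a n.
Proof.
rewrite /lin_comb scaler_sumr; apply: eq_bigr => i _.
by rewrite scalerA -scalerAl mul1r scalerA.
Qed.

Lemma lin_combN v a n : lin_comb v (fun i => - a i) n = - lin_comb v a n.
Proof. by rewrite /lin_comb -sumrN; apply: eq_bigr => i _; rewrite !scaleNr. Qed.

(** A longest independent family spans: adding [x] creates a relation in which the coefficient of
    [x] is invertible. *)
Lemma free_spanning W B n : submodule B -> ~ indep_mod W B n.+1 ->
  exists k v, [/\ (k <= n)%N, forall i, (i < k)%N -> W (v i), free_mod B v k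
    & spans_mod W B v k].
Proof.
move=> smB nWn.
have [k kn [[v vW vfree] nWk]] : exists2 k, (k <= n)%N &
    indep_mod W B k /\ ~ indep_mod W B k.+1.
  elim: n nWn => [|n IHn] nWn.
    by exists 0%N => //; split=> //; exists (fun=> 0).
  have [Wn|/IHn[k kn kP]] := pselect (indep_mod W B n.+1); first by exists n.+1.
  by exists k => //; apply: leqW.
exists k, v; split=> // x Wx; apply: contrapT => nx; apply: nWk.
exists (fun i => if (i < k)%N then v i else x) => [i _|a].
  by case: ifP => // /vW.
rewrite lin_combS ltnn (@eq_lin_comb _ v _ a)//; last by move=> i ->.
have [ak|ak] := eqVneq (a k) 0.
  rewrite ak scale0r scale0r addr0 => /vfree a0 i.
  by rewrite ltnS leq_eqVlt => /orP[/eqP->|/a0].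
move=> /(submoduleZ smB ((a k)^-1)%:A); rewrite scalerDr -lin_combZ scalerA.
rewrite -scalerAl mul1r scalerA mulVf// !scale1r addrC => Bx; case: nx.
exists (fun i => - ((a k)^-1 * a i)); first by rewrite lin_combN opprK.
Qed.

Lemma indep_span_leq W n m :
  indep_mod W [set 0] n -> span_mod W [set 0] m -> (n <= m)%N.
Proof.
move=> [v vW vfree] [k [w [km wW wspan]]]; apply: leq_trans km; rewrite leqNgt.
apply/negP => kn.
have /choice[A AP] : forall i, exists a : nat -> K, (i < n)%N -> v i = lin_comb w a k.
  move=> i; have [/vW/wspan[a /eqP]|_] := ltnP i n; last by exists (fun=> 0).
  by rewrite subr_eq0 => /eqP; exists a.
pose Mx := \matrix_(i < n, j < k) A i j.
have : kermx Mx != 0.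
  by rewrite -mxrank_eq0 mxrank_ker subn_eq0 -ltnNge (leq_ltn_trans (rank_leq_col _)).
move=> /rowV0Pn[u /sub_kermxP uM /negP[]]; apply/eqP/rowP => i.
pose a (i : nat) := oapp (u 0) 0 (insub i).
have aE (j : 'I_n) : a j = u 0 j by rewrite /a valK.
rewrite mxE -aE; apply: vfree => //=.
rewrite /lin_comb (eq_bigr (fun i : 'I_n => \sum_(j < k) (u 0 i * A i j)%:A *: w j)).
  rewrite exchange_big big1//= => j _; rewrite -scaler_suml -scaler_suml.
  have -> : \sum_(l < n) u 0 l * A l j = 0; last by rewrite !scale0r.
  have /rowP/(_ j) := uM; rewrite !mxE => uMj; rewrite -[RHS]uMj.
  by apply: eq_bigr => l _; rewrite mxE.
move=> l _; rewrite aE (AP l)// /lin_comb scaler_sumr; apply: eq_bigr => j _.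
by rewrite scalerA -scalerAl mul1r scalerA.
Qed.

Lemma has_dimP W k : has_dim W k <->
  exists v, [/\ forall i, (i < k)%N -> W (v i), free_mod [set 0] v k
    & spans_mod W [set 0] v k].
Proof.
pose ext T (x0 : T) (b : 'I_k -> T) i := oapp b x0 (insub i).
have extE T x0 (b : 'I_k -> T) (i : 'I_k) : ext T x0 b i = b i by rewrite /ext valK.
split=> [[b [bW bfree bspan]]|[v [vW vfree vspan]]].
  exists (ext _ 0 b); split.
  - by move=> i ik; rewrite -[i]/(val (Ordinal ik)) extE.
  - move=> a a0 i ik; rewrite -[i]/(val (Ordinal ik)).
    apply: (bfree (fun i => a i)); rewrite -[RHS]a0.
    by apply: eq_bigr => j _; rewrite extE.
  - move=> x /bspan[a ->]; exists (ext _ 0 a); apply/eqP; rewrite subr_eq0; apply/eqP.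
    by apply: eq_bigr => j _; rewrite !extE.
exists (fun i => v i); split=> [i|a a0 i|x /vspan[a /eqP]]; first exact: vW.
  rewrite -(extE _ 0 a); apply: vfree => //=; rewrite -[RHS]a0.
  by apply: eq_bigr => j _; rewrite extE.
by rewrite subr_eq0 => /eqP->; exists (fun i => a i).
Qed.

(** Comparing independent with spanning families makes the chosen basis irrelevant; in the infinite
    case, a finite spanning family would yield a basis by [free_spanning]. *)
Lemma dimension_leP W (n : nat) :
  (dimension W <= n%:R%:E)%E <-> span_mod W [set 0] n.
Proof.
have sm0 : submodule [set (0 : V)].
  by apply/submoduleP; split=> //= a u v -> ->; rewrite scaler0 addr0.
rewrite /dimension; case: pselect => [fin|inf].
  case: cid => k /= /has_dimP kP; rewrite lee_fin ler_nat; split=> [kn|spn].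
    by have [v [vW _ vs]] := kP; exists k, v.
  by have [v [vW vf _]] := kP; apply: indep_span_leq spn; exists v.
split=> [|spn]; first by rewrite leye_eq.
case: inf; have [|k [v [_ vW vf vs]]] := @free_spanning W [set 0] n sm0.
  by move/indep_span_leq => /(_ _ spn); rewrite ltnn.
by exists k; apply/has_dimP; exists v.
Qed.
End LinearIndependence.

(** * Homogeneous primes and the degrees of their quotients *)

Section GradedScaling.
Variables (K : fieldType) (G : zmodType) (R : comAlgType K) (M : lmodType R).
Variables (R_ : G -> set R) (M_ : G -> set M).
Hypotheses (dsR : direct_sum R_) (dsM : direct_sum M_).
Hypothesis scaleM : forall g h r x, R_ g r -> M_ h x -> M_ (g + h) (r *: x).

Lemma component_scale_homog r h x t : M_ h x ->
  component dsM (r *: x) t = component dsR r (t - h) *: x.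
Proof.
move=> xh; have [s _ rE] := component_support dsR r.
rewrite [in LHS]rE [in RHS]rE scaler_suml !component_sum scaler_suml.
apply: eq_bigr => g _; have rg := component_in dsR r g.
rewrite (component_homog dsM t (scaleM rg xh)) (component_homog dsR (t - h) rg).
by rewrite subr_eq; case: eqP => _ //; rewrite scale0r.
Qed.

Lemma component_scale r x t : exists s : seq G,
  component dsM (r *: x) t =
  \sum_(h <- s) component dsR r (t - h) *: component dsM x h.
Proof.
have [s _ xE] := component_support dsM x; exists s.
rewrite [in LHS]xE scaler_sumr component_sum; apply: eq_bigr => h _.
exact: component_scale_homog (component_in dsM x h).
Qed.
End GradedScaling.

Section Graded.
Variables (K : fieldType) (G : zmodType) (R : comAlgType K) (M : lmodType R).
Variables (R_ : G -> set R) (M_ : G -> set M).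
Hypotheses (grR : graded_algebra R_) (grM : graded_module R_ M_).

Lemma direct_sum_ring : direct_sum R_. Proof. by case: grR. Qed.
Lemma direct_sum_module : direct_sum M_. Proof. by case: grM. Qed.

Notation compR := (component direct_sum_ring).
Notation compM := (component direct_sum_module).

Lemma graded_scale g h r x : R_ g r -> M_ h x -> M_ (g + h) (r *: x).
Proof. by have [_ scal] := grM; apply: scal. Qed.

Lemma graded_mul g h r s : R_ g r -> R_ h s -> R_ (g + h) (r * s).
Proof. by have [_ _ mul] := grR; apply: mul. Qed.

Lemma graded_const (a : K) : R_ 0 a%:A.
Proof. by have [_ const _] := grR; apply: const. Qed.

Lemma graded1 : R_ 0 1.
Proof. by have := graded_const 1; rewrite scale1r. Qed.

Lemma compR_mul r s t : exists gs : seq G,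
  compR (r * s) t = \sum_(h <- gs) compR r (t - h) * compR s h.
Proof.
exact: (@component_scale K G R R^o R_ R_ direct_sum_ring direct_sum_ring graded_mul).
Qed.

Lemma compM_scale r h x t : M_ h x -> compM (r *: x) t = compR r (t - h) *: x.
Proof. exact: component_scale_homog graded_scale _ _ _ _. Qed.

Lemma lin_comb_in g (v : nat -> R) a n : (forall i, (i < n)%N -> R_ g (v i)) ->
  R_ g (lin_comb (v : nat -> R^o) a n).
Proof.
move=> vg; apply: (in_sum direct_sum_ring) => i.
by rewrite -[g]add0r; apply: graded_mul; [apply: graded_const|apply: vg].
Qed.

(* Primality is tested on homogeneous elements only, so that torsion in G is
   harmless. *)
Definition homogeneous_prime (P : set R) :=
  [/\ @submodule R R^o P, forall r g, P r -> P (compR r g), ~ P 1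
    & forall g h a b, R_ g a -> R_ h b -> P (a * b) -> P a \/ P b].

Definition degrees_mod (P : set R) : set G := [set g | exists2 r, R_ g r & ~ P r].

Section HomogeneousPrime.
Variable P : set R.
Hypothesis primeP : homogeneous_prime P.

Let smP : @submodule R R^o P. Proof. by case: primeP. Qed.

Lemma degrees_mod_subsemigroup : subsemigroup (degrees_mod P).
Proof.
have [_ _ P1 Pab] := primeP.
apply/subsemigroupP; split; first by exists 1 => //; apply: graded1.
move=> g h [a ag Pa] [b bh Pb]; exists (a * b); first exact: graded_mul.
by case/(Pab _ _ _ _ ag bh).
Qed.

(** Turns a set of degrees into a ring ideal: modulo [P], its elements are supported in
    [A + degrees_mod P]. *)
Definition degree_ideal (A : set G) : set R^o :=
  [set r | forall g, (forall a, A a -> ~ degrees_mod P (g - a)) -> P (compR r g)].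

Lemma degree_ideal_submodule A : submodule (degree_ideal A).
Proof.
have /subsemigroupP[_ SD] := degrees_mod_subsemigroup.
apply/submoduleP; split=> [g _|a r s Jr Js g gA].
  by rewrite component_0; apply: (submodule0 smP).
rewrite componentD; apply: (submoduleD smP); last exact: Js.
have [gs ->] := compR_mul a r g; apply: (submodule_sum smP) => h.
(* In a term of degree [g] outside [A + degrees_mod P], either [h] is outside too and the factor
   from [r] is in [P], or [g - h] is not in [degrees_mod P] and the factor from [a] is. *)
have [hA|/existsNP[b /not_implyP[Ab /contrapT hb]]] :=
  pselect (forall b, A b -> ~ degrees_mod P (h - b)).
  exact/(submoduleZ smP)/Jr.
rewrite mulrC; apply: (submoduleZ smP); apply: contrapT => Pgh; apply: (gA b Ab).
rewrite -(subrK h g) -addrA; apply: SD => //.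
by exists (compR a (g - h)) => //; apply: component_in.
Qed.

(** The generators of [degree_ideal A] have finitely many degrees with component outside [P]. These
    degrees dominate [A], and each is dominated by an element of [A]. *)
Lemma degrees_mod_noetherian : noetherian R -> semigroup_noetherian (degrees_mod P).
Proof.
move=> noR A AS; have /subsemigroupP[S0 SD] := degrees_mod_subsemigroup.
have [B /finite_seqP[bs ->] JE] := noR _ (degree_ideal_submodule A).
pose H : set G := [set h | exists2 b, b \in bs & ~ P (compR b h)].
have JH : degree_ideal A `<=` degree_ideal H.
  rewrite JE; apply: smallest_sub; first exact: degree_ideal_submodule.
  move=> b /= bbs g gH; apply: contrapT => Pb; apply: (gH g).
    by exists b.
  by rewrite subrr.
have /choice[supp suppP] : forall b, exists s : seq G, forall h, h \notin s -> compR b h = 0.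
  by move=> b; have [s sP _] := component_support direct_sum_ring b; exists s.
have HA h : H h -> exists a, A a /\ degrees_mod P (h - a).
  move=> [b bbs Pbh]; apply: contrapT => nA; apply: Pbh.
  have : degree_ideal A b by rewrite JE; apply: sub_gen_smallest.
  by apply=> a Aa ha; apply: nA; exists a.
have /choice[f fP] : forall h, exists a, H h -> A a /\ degrees_mod P (h - a).
  move=> h; have [/HA[a ?]|nH] := pselect (H h); first by exists a.
  by exists 0.
exists [seq f h | h <- flatten [seq supp b | b <- bs] & `[< H h >]].
  by move=> _ /mapP[h + ->]; rewrite mem_filter => /andP[/asboolP/fP[]].
move=> a Aa; have [r ra Pr] := AS a Aa.
have : degree_ideal H r.
  apply: JH => g gA; rewrite (component_homog _ g ra); case: eqP => [ga|_].
    by case: (gA a Aa); rewrite ga subrr.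
  exact: (submodule0 smP).
move=> /(_ a); rewrite (component_homog _ a ra) eqxx => Hr.
have [h Hh Sah] : exists2 h, H h & degrees_mod P (a - h).
  by apply: contrapT => nh; apply/Pr/Hr => h Hh Sah; apply: nh; exists h.
have [Af Sf] := fP h Hh.
exists (f h); last by rewrite -(subrK h a) -addrA; apply: SD.
apply: map_f; rewrite mem_filter; apply/andP; split; first exact/asboolP.
have [b bbs Pbh] := Hh; apply/flatten_mapP; exists b => //.
by apply: contrapT => /negP/suppP b0; apply: Pbh; rewrite b0; apply: (submodule0 smP).
Qed.

(** The degrees where [R/P] has dimension greater than [n], possibly infinite. *)
Definition big_degrees n : set G := [set g | indep_mod (R_ g : set R^o) (P : set R^o) n.+1].

Lemma big_degrees_sub n : big_degrees n `<=` degrees_mod P.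
Proof.
move=> g [v vg vf]; exists (v 0%N); first exact: vg.
move=> Pv; have := vf (fun i => (i == 0%N)%:R).
rewrite /lin_comb big_ord_recl big1 => [|i _]; last by rewrite scale0r scale0r.
by rewrite addr0 !scale1r => /(_ Pv 0%N isT)/eqP; rewrite oner_eq0.
Qed.

(** Multiplication by a homogeneous [s] outside [P] is injective modulo [P] on each [R_ g], and
    combinations of elements of [R_ g] stay homogeneous. *)
Lemma big_degrees_add n g h : big_degrees n g -> degrees_mod P h -> big_degrees n (g + h).
Proof.
have [_ _ _ Pab] := primeP.
move=> [v vg vf] [s sh Ps]; exists (fun i => s * v i) => [i /vg vi|a].
  by rewrite addrC; apply: graded_mul.
have -> : lin_comb (fun i => s * v i : R^o) a n.+1 = s * lin_comb (v : nat -> R^o) a n.+1.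
  rewrite /lin_comb mulr_sumr; apply: eq_bigr => i _.
  by rewrite /GRing.scale /= mulrCA.
by move=> /(Pab h g _ _ sh (lin_comb_in a vg))[//|/vf].
Qed.
End HomogeneousPrime.

(** * Prime filtrations *)

Definition homogeneous_submodule (N : set M) :=
  submodule N /\ forall x t, N x -> N (compM x t).

(* Encodes a filtration with quotients (R/P i)(- d i), i < m: at each degree the
   dimension of N is at least that of every quotient and at most their sum. *)
Definition prime_filtered (N : set M) := exists m (P : nat -> set R) (d : nat -> G),
  [/\ forall i, (i < m)%N -> homogeneous_prime (P i),
      forall i t n, (i < m)%N -> indep_mod (R_ (t - d i) : set R^o) (P i : set R^o) n ->
        indep_mod (N `&` M_ t) [set 0] n
    & forall t n,
        (forall i, (i < m)%N -> ~ indep_mod (R_ (t - d i) : set R^o) (P i : set R^o) n.+1) ->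
        span_mod (N `&` M_ t) [set 0] (m * n)].

Definition adjoin (N : set M) (x : M) : set M :=
  [set y | exists n r, N n /\ y = n + r *: x].

Definition colon (N : set M) (x : M) : set R^o := [set r | N (r *: x)].

Lemma colon_submodule N x : submodule N -> submodule (colon N x).
Proof.
move=> smN; apply/submoduleP; split; first by rewrite /colon /= scale0r; apply: submodule0.
move=> a r s Nr Ns; rewrite /colon /= scalerDl -scalerA.
by apply: submoduleD => //; apply: submoduleZ.
Qed.

Lemma adjoin_homogeneous N g x : homogeneous_submodule N -> M_ g x ->
  homogeneous_submodule (adjoin N x).
Proof.
move=> [smN hN] xg; split.
  apply/submoduleP; split.
    by exists 0, 0; rewrite scale0r addr0; split=> //; apply: submodule0.
  move=> a _ _ [n [r [Nn ->]]] [n' [r' [Nn' ->]]].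
  exists (a *: n + n'), (a * r + r'); split.
    by apply: submoduleD => //; apply: submoduleZ.
  by rewrite scalerDr scalerA addrACA -scalerDl.
move=> _ t [n [r [Nn ->]]]; exists (compM n t), (compR r (t - g)).
split; first exact: hN.
by rewrite componentD (compM_scale _ _ xg).
Qed.

Lemma adjoin_sub N x : N `<=` adjoin N x.
Proof. by move=> y Ny; exists y, 0; rewrite scale0r addr0. Qed.

Lemma adjoin_mem N x : submodule N -> adjoin N x x.
Proof. by move=> smN; exists 0, 1; rewrite scale1r add0r; split=> //; apply: submodule0. Qed.

Lemma prime_filtered0 : prime_filtered [set 0].
Proof.
exists 0%N, (fun=> set0), (fun=> 0); split=> // t n _.
exists 0%N, (fun=> 0); split=> // _ [-> _]; exists (fun=> 0).
by rewrite /= /lin_comb big_ord0 subrr.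
Qed.

(** The new quotient [adjoin N x / N] is [R / colon N x] shifted by [g], through [r |-> r *: x]. *)
Lemma prime_filtered_adjoin_prime N g x :
  homogeneous_submodule N -> prime_filtered N -> M_ g x ->
  homogeneous_prime (colon N x) -> prime_filtered (adjoin N x).
Proof.
move=> [smN hN] [m [P [d [primeP lowP upP]]]] xg primeN.
pose P' i := if (i < m)%N then P i else colon N x.
pose d' i := if (i < m)%N then d i else g.
exists m.+1, P', d'; split.
- by move=> i _; rewrite /P'; case: ifP => // /primeP.
- move=> i t n _; rewrite /P' /d'; case: ifP => [im|_].
    move=> /(lowP _ _ _ im)[v vW vf]; exists v => // j /vW[Nv Mv]; split=> //.
    exact: adjoin_sub.
  move=> [r rR rf]; exists (fun j => r j *: x) => [j jn|a].
    split; last by have := graded_scale (rR j jn) xg; rewrite subrK.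
    by exists 0, (r j); rewrite add0r; split=> //; apply: submodule0.
  move=> /= a0; apply: rf; rewrite /colon /=.
  suff -> : lin_comb (r : nat -> R^o) a n *: x = 0 by apply: submodule0.
  by rewrite -[RHS]a0 /lin_comb scaler_suml; apply: eq_bigr => j _; rewrite scalerA.
move=> t n nP.
have [|k [v [kmn vW vs]]] := upP t n.
  by move=> i im; have := nP i (ltnW im); rewrite /P' /d' im.
have [|l [r [ln rR _ rs]]] := @free_spanning K R R^o (R_ (t - g)) (colon N x) n (colon_submodule x smN).
  by have := nP m (ltnSn m); rewrite /P' /d' ltnn.
exists (k + l)%N, (fun i => if (i < k)%N then v i else r (i - k)%N *: x); split.
- by rewrite mulSn addnC leq_add.
- move=> i ikl; case: ltnP => [/vW[Nv Mv]|ki]; first by split=> //; apply: adjoin_sub.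
  have il : (i - k < l)%N by rewrite ltn_subLR.
  split; last by have := graded_scale (rR _ il) xg; rewrite subrK.
  by exists 0, (r (i - k)%N); rewrite add0r; split=> //; apply: submodule0.
move=> y [[n0 [s [Nn0 yE]]] yt].
have [b Nb] := rs (compR s (t - g)) (component_in _ _ _).
have [|a /= ya] := vs (y - lin_comb (fun j => r j *: x) b l).
  have rxE : lin_comb (fun j => r j *: x) b l = lin_comb (r : nat -> R^o) b l *: x.
    by rewrite /lin_comb scaler_suml; apply: eq_bigr => j _; rewrite scalerA.
  split; last first.
    rewrite rxE -[t](subrK g); apply: (subgroupP direct_sum_module _).2.
      by rewrite subrK.
    by apply: graded_scale => //; apply: lin_comb_in.
  (* [n0] and [s] need not be homogeneous, but [y] is, so only their components of degrees [t] and
     [t - g] matter. *)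
  have -> : y = compM n0 t + compR s (t - g) *: x.
    rewrite -(compM_scale _ _ xg).
    by rewrite -componentD -yE (component_homog _ t yt) eqxx.
  rewrite rxE -addrA -scalerBl; apply: submoduleD => //; exact: hN.
exists (fun i => if (i < k)%N then a i else b (i - k)%N).
rewrite /= (lin_comb_cat v (fun j => r j *: x)) [_ + lin_comb _ b _]addrC.
by rewrite opprD addrA.
Qed.

(** A maximal annihilator of a nonzero element of [M / N] is prime: if [a] does not kill [r *: x],
    then [a * r] gives a larger, hence equal, annihilator. *)
Lemma homogeneous_prime_colon N g x h r : homogeneous_submodule N -> M_ g x ->
  R_ h r -> ~ N (r *: x) ->
  (forall h' r', R_ h' r' -> ~ N (r' *: x) ->
    colon N (r *: x) `<=` colon N (r' *: x) ->
    colon N (r' *: x) = colon N (r *: x)) ->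
  homogeneous_prime (colon N (r *: x)).
Proof.
move=> [smN hN] xg rh Nrx cmax; split.
- exact: colon_submodule.
- move=> s k /(hN _ (k + (h + g))).
  by rewrite (compM_scale _ _ (graded_scale rh xg)) addrK.
- by rewrite /colon /= scale1r.
- move=> k l a b ak _; rewrite /colon /= => Nab.
  have [Na|nNa] := pselect (N (a *: (r *: x))); first by left.
  right; suff : colon N ((a * r) *: x) b.
    rewrite (cmax (k + h) (a * r))//; first exact: graded_mul.
      by rewrite -scalerA.
    move=> s Ns; rewrite /colon /= !scalerA mulrCA -scalerA.
    by apply: submoduleZ => //; rewrite -scalerA.
  by rewrite /colon /= scalerA mulrA (mulrC b) -scalerA.
Qed.

(** Noetherian induction on [colon N x]. First adjoin a multiple [r *: x] with prime annihilator
    modulo [N]; this puts [r] into the colon ideal of [x], which strictly grows. *)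
Lemma prime_filtered_adjoin N g x : noetherian R ->
  homogeneous_submodule N -> prime_filtered N -> M_ g x ->
  prime_filtered (adjoin N x).
Proof.
move=> noR hN fN xg; apply: contrapT => nfN.
(* The counterexample with largest colon ideal is sought over all [N], as the induction enlarges
   [N]. *)
pose F : set (set R^o) := [set I | exists N g x, [/\ homogeneous_submodule N,
  prime_filtered N, M_ g x, ~ prime_filtered (adjoin N x) & I = colon N x]].
have [||I [{}N [{}g [{}x [{}hN {}fN {}xg {}nfN {I}->]]]] Imax] := noetherian_max noR (F := F).
- by move=> _ [N' [_ [x' [[smN' _] _ _ _ ->]]]]; apply: colon_submodule.
- by exists (colon N x), N, g, x.
have [smN _] := hN.
have Nx : ~ N x.
  move=> Nx; apply: nfN; suff -> : adjoin N x = N by [].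
  apply/seteqP; split; last exact: adjoin_sub.
  by move=> _ [n [r [Nn ->]]]; apply: submoduleD => //; apply: submoduleZ.
pose F' : set (set R^o) := [set I | exists h r,
  [/\ R_ h r, ~ N (r *: x) & I = colon N (r *: x)]].
have [||J [h [r [rh Nrx {J}->]]] Jmax] := noetherian_max noR (F := F').
- by move=> _ [_ [r [_ _ ->]]]; apply: colon_submodule.
- by exists (colon N (1 *: x)), 0, 1; split=> //; [apply: graded1|rewrite scale1r].
have primeP : homogeneous_prime (colon N (r *: x)).
  apply: (homogeneous_prime_colon hN xg rh Nrx) => h' r' rh' Nrx'.
  by apply: Jmax; exists h', r'.
have rxg := graded_scale rh xg.
have hN' := adjoin_homogeneous hN rxg.
have fN' := prime_filtered_adjoin_prime hN fN rxg primeP.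
apply: contrapT => nfN0; have : colon (adjoin N (r *: x)) x = colon N x.
  apply: Imax; last by move=> s; apply: adjoin_sub.
  exists (adjoin N (r *: x)), g, x; split=> // fN''; apply: nfN.
  suff -> : adjoin N x = adjoin (adjoin N (r *: x)) x by [].
  apply/seteqP; split=> y.
    by move=> [n [s [Nn ->]]]; exists n, s; split=> //; apply: adjoin_sub.
  move=> [_ [s [[n [s' [Nn ->]]] ->]]]; exists n, (s' * r + s); split=> //.
  by rewrite scalerA -addrA -scalerDl.
move=> /seteqP[/(_ r) + _]; rewrite /colon /= => cr; apply/Nrx/cr.
exact: adjoin_mem.
Qed.

(** The homogeneous components of the generators are adjoined one by one, starting from 0. *)
Lemma prime_filtered_setT : noetherian R ->
  finitely_generated (@submodule R M) [set: M] -> prime_filtered [set: M].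
Proof.
move=> noR [B /finite_seqP[bs ->] ME].
have extend (xs : seq M) : (forall x, x \in xs -> exists g, M_ g x) ->
    exists N, [/\ homogeneous_submodule N, prime_filtered N & forall x, x \in xs -> N x].
  elim: xs => [|x xs IHxs] hxs.
    exists [set 0]; split=> //; last exact: prime_filtered0.
    split; last by move=> _ t ->; apply: component_0.
    by apply/submoduleP; split=> //= a u v -> ->; rewrite scaler0 addr0.
  have [|N [hN fN xsN]] := IHxs; first by move=> y yxs; apply: hxs; rewrite inE yxs orbT.
  have [g xg] := hxs x (mem_head _ _).
  exists (adjoin N x); split; first exact: adjoin_homogeneous xg.
    exact: prime_filtered_adjoin xg.
  move=> y; rewrite inE => /orP[/eqP->|/xsN Ny]; last exact: adjoin_sub.
  by apply: adjoin_mem; case: hN.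
have /choice[supp suppP] : forall b, exists s, b = \sum_(g <- s) compM b g.
  by move=> b; have [s _ bE] := component_support direct_sum_module b; exists s.
have [|N [[smN _] fN xsN]] := extend (flatten [seq [seq compM b g | g <- supp b] | b <- bs]).
  by move=> x /flatten_mapP[b _ /mapP[g _ ->]]; exists g; apply: component_in.
suff <- : N = [set: M] by [].
apply/seteqP; split=> //; rewrite ME; apply: smallest_sub => // b /= bbs.
rewrite (suppP b) big_seq; apply: (big_ind N); first exact: submodule0.
  exact: submoduleD.
move=> g gb; apply: xsN; apply/flatten_mapP; exists b => //.
exact: map_f.
Qed.
End Graded.
Theorem theorem7p3 (K : fieldType) (G : zmodType) (R : comAlgType K)
    (M : lmodType R) (R_ : G -> set R) (M_ : G -> set M) (S T : set G)
    (G_fg : finitely_generated (@subgroup G) [set: G])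
    (R_graded : graded_algebra R_)
    (R_noeth : noetherian R)
    (R0_fg : finitely_generated (@subalgebra K R) (R_ 0))
    (M_graded : graded_module R_ M_)
    (M_fg : finitely_generated (@submodule R M) [set: M])
    (S_semigroup : subsemigroup S)
    (S_fg : finitely_generated (@subsemigroup G) S)
    (S_deg : forall g r, R_ g r -> r <> 0 -> S g)
    (T_fg : fg_semigroup_module S T)
    (T_deg : forall t x, M_ t x -> x <> 0 -> T t)
    (H_lim : forall c d, S c -> ~ torsion c -> T d ->
      (fun k : nat => hilbert_function M_ (c *+ k + d)) @ \oo --> +oo%E) :
  forall C : nat,
    finite_set [set t | T t /\ (hilbert_function M_ t <= C%:R%:E)%E].
Proof.
move=> C.
have [N [pi [piD pi_surj]]] := lattice_cover G_fg.
have [m [P [d [primeP lowP upP]]]] := prime_filtered_setT R_graded M_graded R_noeth M_fg.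
(* With the same threshold [C] for all [m] quotients, the complement of [W] contains every [t] with
   [H(M, t) <= C], and on it [H(M, t) <= m * C]. *)
pose W : set G := [set t | exists2 i, (i < m)%N & big_degrees R_ (P i) C (t - d i)].
have HW t : (hilbert_function M_ t <= C%:R%:E)%E -> ~ W t.
  move=> /dimension_leP spn [i im /(lowP _ _ _ im)]; rewrite setTI.
  by move=> /indep_span_leq/(_ spn); rewrite ltnn.
have WH t : ~ W t -> (hilbert_function M_ t <= (m * C)%:R%:E)%E.
  move=> nW; apply/dimension_leP; rewrite -[M_ t]setTI.
  by apply: upP => i im Wi; apply: nW; exists i.
have tameW : tame (pi @^-1` W).
  apply: tame_setU_iter => i im; have pP := primeP i im.
  apply: (@tame_translate _ _ _ piD pi_surj (degrees_mod R_ (P i))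
    (big_degrees R_ (P i) C)).
  - exact: degrees_mod_subsemigroup pP.
  - exact: degrees_mod_noetherian pP R_noeth.
  - exact: big_degrees_sub.
  - by move=> g h; apply: (big_degrees_add pP).
apply: contrapT => infH.
have [|c [e [Sc nc Te lineW]]] := line_outside piD pi_surj S_fg T_fg tameW.
  by apply: sub_infinite_set infH => t [Tt /HW].
have /cvgeyPgt/(_ (m * C)%:R)/filter_ex[k] := H_lim c e Sc nc Te.
by rewrite ltNge WH.
Qed.
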